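(* Let $r\geq 2$ and let $G$ be a standard multigraph on $n$ vertices. If $e(G)>2t_{r-1}(n)$, then $G$ contains a copy of some element of $\bar{\mathcal K}_{r}$.
   Context: A standard multigraph is a loopless multigraph in which any two distinct vertices $x,y$ are joined by $\mu(xy)\in\{0,1,2\}$ edges (light if $1$, heavy if $2$); $e(G)$ is the total number of edges counted with multiplicity. $t_{r-1}(n)$ is the maximum number of edges of an $(r-1)$-partite simple graph on $n$ vertices. $\bar{\mathcal K}_r$ is the family of standard multigraphs on $r$ vertices in which every pair of distinct vertices is joined by a heavy edge except for the pairs of some matching, which are joined by light edges. $G$ contains a copy of $U$ if there is an injection $\phi:V(U)\to V(G)$ with $\mu_G(\phi(x)\phi(y))\geq\mu_U(xy)$ for all distinct $x,y\in V(U)$. *)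

(* Defs.v *)
From mathcomp Require Import all_boot.

Set Implicit Arguments.
Unset Strict Implicit.
Unset Printing Implicit Defensive.

Section PairSets.

Variable T : finType.

Definition pairs : {set {set T}} := [set A : {set T} | #|A| == 2].

Definition matching (M : {set {set T}}) : bool :=
  (M \subset pairs) && trivIset M.

(* A simple graph on T is identified with its edge set E \subset pairs.
   As usual, the parts of a k-partition are allowed to be empty. *)
Definition partite (k : nat) (E : {set {set T}}) : bool :=
  [exists c : {ffun T -> 'I_k},
    [forall x, forall y, ([set x; y] \in E) ==> (c x != c y)]].

End PairSets.

Definition turan (k n : nat) : nat :=
  \max_(E : {set {set 'I_n}} | (E \subset pairs 'I_n) && partite k E) #|E|.

(* Multiplicities are attached to unordered pairs, so symmetry is built in;
   values on sets that are not pairs are normalised to 0. Since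
   [set x; x] = [set x], this includes the absence of loops. *)
Record stdMultigraph (T : finType) := StdMultigraph {
  multiplicity : {set T} -> nat;
  multiplicity_loopless : forall A, A \notin pairs T -> multiplicity A = 0;
  multiplicity_le2 : forall A, multiplicity A <= 2
}.

Definition mu (T : finType) (G : stdMultigraph T) (x y : T) : nat :=
  multiplicity G [set x; y].

Definition num_edges (T : finType) (G : stdMultigraph T) : nat :=
  \sum_(A in pairs T) multiplicity G A.

(* The members of \bar K_r, represented on the vertex set 'I_r. *)
Definition in_barK (r : nat) (U : stdMultigraph 'I_r) : Prop :=
  exists2 M : {set {set 'I_r}}, matching M &
    forall x y : 'I_r, x != y ->
      mu U x y = if [set x; y] \in M then 1 else 2.

Definition contains_copy (S T : finType) (G : stdMultigraph T)
    (U : stdMultigraph S) : Prop :=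
  exists2 phi : S -> T, injective phi &
    forall x y : S, x != y -> mu U x y <= mu G (phi x) (phi y).

(* Main.v *)
(* Call a vertex set admissible if all its pairs are joined and the light ones
   form a matching.  As in the classical proof of Turán's theorem, remove a
   densest admissible set K of r-1 vertices (if there is none, use induction on
   r).  A vertex v outside K sends at most 2(r-2) edges to K.  Otherwise all
   edges from v to K are heavy except for at most one light edge vx, and then
   either K + v is admissible, or x already lies on a light edge inside K and
   K - x + v is admissible with more edges than K.  Since
   t_{r-1}(n) = C(r-1,2) + (r-2)(n-r+1) + t_{r-1}(n-r+1), induction on n
   concludes.  Edges are counted by summing over ordered pairs of vertices. *)
Require Import Defs.
From mathcomp Require Import all_boot zify.

Set Implicit Arguments.
Unset Strict Implicit.
Unset Printing Implicit Defensive.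

(** * Ordered pairs, colourings and Turán numbers *)

Lemma sum_ordered_pairs (T : finType) (f : {set T} -> nat) :
    (forall x, f [set x] = 0) ->
  \sum_x \sum_y f [set x; y] = 2 * \sum_(A in pairs T) f A.
Proof.
move=> f1.
rewrite pair_bigA /= (bigID (fun p : T * T => p.1 != p.2)) /=.
rewrite [X in _ + X]big1 ?addn0; last first.
  by move=> [x y] /= /negPn/eqP ->; rewrite setUid f1.
rewrite (partition_big (fun p : T * T => [set p.1; p.2]) (mem (pairs T))) /=;
  last by move=> p np; rewrite inE cards2 np.
rewrite big_distrr /=; apply: eq_bigr => A; rewrite inE => /cards2P[a [b [nab ->]]].
rewrite (eq_bigr (fun=> f [set a; b])); last by move=> p /andP[_ /eqP ->].
rewrite sum_nat_const; congr (_ * _).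
(* The factor 2: the fibre over [[set a; b]] is exactly [(a, b)] and [(b, a)]. *)
rewrite -[RHS](_ : #|[set (a, b); (b, a)]| = 2); last first.
  by rewrite cards2 xpair_eqE negb_and nab.
rewrite -cardsE; apply: eq_card => -[x y]; rewrite !inE !xpair_eqE /=.
apply/andP/orP => [[nxy /eqP eqS]|].
- have := set21 x y; have := set22 x y; rewrite eqS !inE.
  by move: nxy => /[swap] /orP[] /eqP -> /[swap] /orP[] /eqP ->; rewrite !eqxx; auto.
- by case=> /andP[/eqP -> /eqP ->]; [|rewrite setUC eq_sym]; rewrite eqxx.
Qed.

Lemma sum_ordered_pairs_in (T : finType) (E : {set {set T}}) :
  E \subset pairs T -> \sum_x \sum_y ([set x; y] \in E) = 2 * #|E|.
Proof.
move=> /subsetP sEP; rewrite (sum_ordered_pairs (f := fun A => (A \in E) : nat)).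
  congr (_ * _); rewrite -big_mkcondr sum1_card.
  by apply: eq_card => A; rewrite !unfold_in /= andb_idl // => /sEP.
by move=> x; apply/eqP; rewrite eqb0; apply: contraT => /negPn /sEP; rewrite inE cards1.
Qed.

(** The bichromatic pairs of a colouring form a k-partite graph. With the converse below, [turan]
    can be handled through colourings of any finite type. *)
Lemma bichromatic_le_turan (T : finType) (k : nat) (c : T -> 'I_k) :
  \sum_x \sum_y (c x != c y) <= 2 * turan k #|T|.
Proof.
pose d (i : 'I_#|T|) := c (enum_val i).
have -> : \sum_x \sum_y (c x != c y) = \sum_i \sum_j (d i != d j).
  rewrite (reindex _ (onW_bij _ (enum_val_bij T))); apply: eq_bigr => i _.
  by rewrite (reindex _ (onW_bij _ (enum_val_bij T))).
pose E := [set A in pairs 'I_#|T| | [exists i in A, exists j in A, d i != d j]].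
have EP i j : ([set i; j] \in E) = (d i != d j).
  rewrite !inE; apply/andP/idP => [[_ /'exists_in_existsP]|nd]; last first.
    rewrite cards2 (contraNneq _ nd) => [|-> //]; split=> //.
    apply/exists_inP; exists i; rewrite ?set21 //.
    by apply/exists_inP; exists j; rewrite ?set22.
  case=> u; rewrite !inE => uP [v /andP[]]; rewrite !inE => vP.
  by case/orP: uP vP => /eqP -> /orP[] /eqP ->; rewrite ?eqxx // eq_sym.
have sEP : E \subset pairs _ by apply/subsetP=> A; rewrite inE => /andP[].
under eq_bigr do under eq_bigr do rewrite -EP.
rewrite sum_ordered_pairs_in //.
rewrite leq_mul2l /=; apply: leq_bigmax_cond; rewrite sEP.
apply/existsP; exists [ffun i => d i]; apply/forallP => i; apply/forallP => j.
by rewrite EP !ffunE; apply/implyP.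
Qed.

Lemma turan_le_bichromatic (k n : nat) : 0 < k ->
  exists c : 'I_n -> 'I_k, 2 * turan k n <= \sum_x \sum_y (c x != c y).
Proof.
move=> k_gt0.
pose Q (E : {set {set 'I_n}}) := (E \subset pairs 'I_n) && partite k E.
(* The empty graph is k-partite because a colour exists, so the maximum is attained by some
   graph. *)
have Q0 : Q set0.
  rewrite /Q sub0set; apply/existsP; exists [ffun=> Ordinal k_gt0].
  by apply/forallP => i; apply/forallP => j; rewrite inE.
rewrite /turan (bigmax_eq_arg (P := Q) set0) //.
case: arg_maxnP => // E /andP[sEP /existsP[c cP]] _; exists c.
rewrite -sum_ordered_pairs_in //.
apply: leq_sum => x _; apply: leq_sum => y _.
by move/forallP/(_ x)/forallP/(_ y): cP; case: (_ \in E) => //= ->.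
Qed.

Lemma turan_leS (k n : nat) : turan k n <= turan k.+1 n.
Proof.
apply/bigmax_leqP => E /andP[sEP /existsP[c cP]].
apply: leq_bigmax_cond; rewrite sEP; apply/existsP.
exists [ffun x => lift ord0 (c x)].
apply/forallP => x; apply/forallP => y; rewrite !ffunE (inj_eq lift_inj).
by move/forallP/(_ x)/forallP/(_ y): cP.
Qed.

(** Extend an optimal colouring by k+1 new vertices, one of each colour: every old vertex differs in
    colour from k new ones, and the new ones differ pairwise. The factor 4 matches [weight], which
    counts each edge twice. *)
Lemma turan_step (k n : nat) :
  4 * turan k.+1 n + 4 * (k * n) + 2 * (k.+1 * k) <= 4 * turan k.+1 (n + k.+1).
Proof.
have [c cP] := turan_le_bichromatic n (ltn0Sn k).
pose d (u : 'I_n + 'I_k.+1) := match u with inl i => c i | inr j => j end.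
have := bichromatic_le_turan d; rewrite card_sum !card_ord big_sumType /=.
have neqE (j : 'I_k.+1) : \sum_(i : 'I_k.+1) (j != i) = k.
  rewrite -big_mkcond sum1_card /= -[RHS]/k.+1.-1 -[in RHS](card_ord k.+1).
  by rewrite -(cardC1 j); apply: eq_card => i; rewrite !inE eq_sym.
have neqE' (j : 'I_k.+1) : \sum_(i : 'I_k.+1) (i != j) = k.
  by rewrite -[RHS](neqE j); apply: eq_bigr => i _; rewrite eq_sym.
under eq_bigr do rewrite big_sumType /= neqE.
under [X in _ + X]eq_bigr do rewrite big_sumType /= neqE.
rewrite !big_split /= !sum_nat_const !card_ord.
rewrite [X in _ + (X + _)]exchange_big /=.
under [X in _ + (X + _)]eq_bigr do rewrite neqE'.
rewrite sum_nat_const card_ord.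
move: cP; set S := \sum_(i < n) _; nia.
Qed.

(** * Admissible sets and the exchange argument *)

Section Admissible.

Variables (T : finType) (m : T -> T -> nat).
Hypotheses (mC : forall x y, m x y = m y x) (m0 : forall x, m x x = 0)
  (m2 : forall x y, m x y <= 2).

Definition degree_in (K : {set T}) (x : T) := \sum_(y in K) m x y.
Definition weight (K : {set T}) := \sum_(x in K) degree_in K x.

(* Every vertex of K misses at most one of the 2(|K|-1) possible edges to the
   rest of K: all pairs are joined and the light ones form a matching. *)
Definition admissible (K : {set T}) :=
  [forall x in K, 2 * #|K| <= degree_in K x + 3].

Lemma degree_inU1 (K : {set T}) v x :
  v \notin K -> degree_in (v |: K) x = m x v + degree_in K x.
Proof. by move=> vK; rewrite /degree_in big_setU1. Qed.

Lemma degree_inD1 (K : {set T}) v x :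
  v \in K -> degree_in K x = m x v + degree_in (K :\ v) x.
Proof. by move=> vK; rewrite /degree_in (big_setD1 v). Qed.

Lemma degree_in_le (K : {set T}) x : degree_in K x <= 2 * #|K|.
Proof. by rewrite mulnC -sum_nat_const; apply: leq_sum => y _. Qed.

Lemma weightU1 (K : {set T}) v :
  v \notin K -> weight (v |: K) = weight K + 2 * degree_in K v.
Proof.
move=> vK; rewrite /weight big_setU1 //= degree_inU1 // m0.
under eq_bigr do rewrite degree_inU1 //.
rewrite big_split /=; under eq_bigr do rewrite mC.
rewrite -/(degree_in K v); lia.
Qed.

Lemma weightD (K S : {set T}) : K \subset S ->
  weight S =
    weight K + weight (S :\: K) + 2 * \sum_(x in S :\: K) degree_in K x.
Proof.
move=> sKS; set R := S :\: K.
have sumD (F : T -> nat) : \sum_(x in S) F x = \sum_(x in K) F x + \sum_(x in R) F x.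
  by rewrite (big_setID K) /= (setIidPr sKS).
rewrite /weight sumD.
under eq_bigr do rewrite /degree_in sumD.
under [X in _ + X]eq_bigr do rewrite /degree_in sumD.
rewrite !big_split /=.
have -> : \sum_(x in K) \sum_(y in R) m x y = \sum_(x in R) degree_in K x.
  by rewrite exchange_big; apply: eq_bigr => x _; apply: eq_bigr => y _.
rewrite /degree_in; lia.
Qed.

Lemma admissible_weight_le (K : {set T}) : weight K <= 2 * (#|K| * #|K|.-1).
Proof.
rewrite mulnCA -sum_nat_const; apply: leq_sum => x xK.
rewrite (degree_inD1 _ xK) m0 (cardsD1 x K) xK.
by apply: leq_trans (degree_in_le _ _) _.
Qed.

Lemma degree_out_le (S K : {set T}) v :
    K \subset S -> admissible K ->
    (forall K' : {set T}, K' \subset S -> admissible K' -> #|K'| = #|K| ->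
       weight K' <= weight K) ->
    (forall K' : {set T}, K' \subset S -> admissible K' -> #|K'| <> #|K|.+1) ->
    v \in S -> v \notin K ->
  degree_in K v <= 2 * #|K|.-1.
Proof.
move=> sKS /forall_inP admK maxK noext vS vK.
rewrite leqNgt; apply/negP => dv.
have sU (A : {set T}) : A \subset K -> v |: A \subset S.
  by move=> sAK; rewrite subUset sub1set vS (subset_trans sAK).
(* By [dv], v misses at most one of the 2|K| possible edges to K. *)
have heavy x y : x \in K -> y \in K -> y != x -> m v x < 2 -> m v y = 2.
  move=> xK yK nyx lx; have yKx : y \in K :\ x by rewrite !inE nyx.
  have := degree_in_le (K :\ x :\ y) v.
  move: dv; rewrite (degree_inD1 _ xK) (degree_inD1 _ yKx).
  rewrite (cardsD1 x K) xK (cardsD1 y (K :\ x)) yKx.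
  by have := m2 v y; lia.
case: (boolP (admissible (v |: K))) => [adm|].
  by apply: noext adm _; [exact: sU | rewrite cardsU1 vK].
(* The vertex violating admissibility is not v, by [dv]. So it is some x in K, and it already misses
   one edge inside K and another one to v. *)
rewrite negb_forall_in => /exists_inP[x].
rewrite !inE cardsU1 vK => /predU1P[->|xK].
  rewrite degree_inU1 // m0; lia.
rewrite degree_inU1 // mC => dx.
have dx' := admK _ xK.
have vx : m v x < 2 by lia.
have vKx : v \notin K :\ x by rewrite !inE (negPf vK) andbF.
have cK : #|K| = #|K :\ x|.+1 by rewrite (cardsD1 x K) xK.
have eqK : K = x |: (K :\ x) by rewrite setD1K.
have wK : weight K = weight (K :\ x) + 2 * degree_in (K :\ x) x.
  by rewrite [in LHS]eqK weightU1 // !inE eqxx.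
have dvx := degree_inD1 v xK.
have dxx := degree_inD1 x xK.
have lev := degree_in_le (K :\ x) v.
have m0x := m0 x.
(* Swapping x for v gains weight: v sends at least 2|K|-2 edges to K - x, while x sends only
   2|K|-3. *)
have := maxK (v |: (K :\ x)); rewrite weightU1 // cardsU1 vKx add1n -cK wK.
suff adm : admissible (v |: (K :\ x)).
  by move/(_ (sU _ (subsetDl _ _)) adm erefl); lia.
apply/forall_inP => y; rewrite cardsU1 vKx add1n -cK degree_inU1 //.
case/setU1P=> [->|]; first by rewrite m0; lia.
rewrite !inE => /andP[nyx yK].
(* The heavy edge yv replaces yx, so the degree of y does not drop. *)
have := admK _ yK; rewrite (degree_inD1 _ xK) (mC y v) (heavy _ _ xK yK nyx vx).
by have := m2 y x; lia.
Qed.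

(** Outer induction on k, inner induction on |S|. For k = 0, singletons are always admissible, so S
    is empty. *)
Lemma weight_le_turan (k : nat) (S : {set T}) :
    (forall K : {set T}, K \subset S -> admissible K -> #|K| <> k.+1) ->
  weight S <= 4 * turan k #|S|.
Proof.
elim: k S => [|k IHk] S noK.
  have [->|[x xS]] := set_0Vmem S; first by rewrite /weight big_set0.
  case: (noK [set x]); rewrite ?sub1set ?cards1 //.
  by apply/forall_inP => y _; rewrite cards1; lia.
have [n leSn] := ubnP #|S|.
elim: n S leSn noK => // n IHn S leSn noK.
pose P (K : {set T}) := [&& K \subset S, admissible K & #|K| == k.+1].
case: (pickP P) => [K0 PK0|noP]; last first.
  (* Without an admissible set of size k+1 in S, the outer hypothesis already applies to S. *)
  apply: leq_trans (IHk S _) _; last by rewrite leq_mul2l turan_leS.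
  by move=> K sKS aK cK; have := noP K; rewrite /P sKS aK cK eqxx.
have [K /and3P[sKS aK /eqP cK] maxK] := arg_maxnP weight PK0.
pose R := S :\: K.
have cS : #|S| = #|R| + k.+1.
  by rewrite cardsD (setIidPr sKS) cK; have := subset_leq_card sKS; lia.
have wR : weight R <= 4 * turan k.+1 #|R|.
  apply: IHn => [|K' sK'R]; first by lia.
  by apply: noK; apply: subset_trans sK'R (subsetDl _ _).
have out : \sum_(x in R) degree_in K x <= #|R| * (2 * k).
  rewrite -sum_nat_const; apply: leq_sum => v; rewrite inE => /andP[vK vS].
  have -> : k = #|K|.-1 by rewrite cK.
  apply: (@degree_out_le S) => // K' sK'S aK' cK'.
    by apply: maxK; rewrite /P sK'S aK' cK' cK eqxx.
  by apply: (noK K') => //; rewrite cK' cK.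
(* The weight inside K, the weight of R and the edges between them match the three terms of
   [turan_step]. *)
have := turan_step k #|R|; rewrite -cS.
have := admissible_weight_le K; rewrite cK /=.
rewrite (weightD sKS) -/R; lia.
Qed.

(** An unjoined pair would cost x two edges, while admissibility allows a loss of one. *)
Lemma admissible_joined (K : {set T}) x y :
  admissible K -> x \in K -> y \in K -> x != y -> 0 < m x y.
Proof.
move=> /forall_inP aK xK yK nxy.
have yKx : y \in K :\ x by rewrite !inE eq_sym nxy.
have := aK _ xK; rewrite (degree_inD1 _ xK) (degree_inD1 _ yKx) m0.
rewrite (cardsD1 x K) xK (cardsD1 y (K :\ x)) yKx.
have := degree_in_le (K :\ x :\ y) x; lia.
Qed.

(** Two distinct non-heavy pairs at x would again cost x at least two edges. *)
Lemma admissible_light_unique (K : {set T}) x y z :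
    admissible K -> x \in K -> y \in K -> z \in K -> x != y -> x != z ->
  m x y < 2 -> m x z < 2 -> y = z.
Proof.
move=> /forall_inP aK xK yK zK nxy nxz ly lz; apply/eqP/negPn/negP => nyz.
have yKx : y \in K :\ x by rewrite !inE eq_sym nxy.
have zKxy : z \in K :\ x :\ y by rewrite !inE eq_sym nyz eq_sym nxz.
have := aK _ xK.
rewrite (degree_inD1 _ xK) (degree_inD1 _ yKx) (degree_inD1 _ zKxy) m0.
rewrite (cardsD1 x K) xK (cardsD1 y (K :\ x)) yKx (cardsD1 z (K :\ x :\ y)) zKxy.
have := degree_in_le (K :\ x :\ y :\ z) x; lia.
Qed.

End Admissible.

(** * From admissible sets to copies of members of $\bar{\mathcal K}_r$ *)

Lemma mu_sym (T : finType) (G : stdMultigraph T) x y : mu G x y = mu G y x.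
Proof. by rewrite /mu setUC. Qed.

Lemma mu_loopless (T : finType) (G : stdMultigraph T) x : mu G x x = 0.
Proof. by rewrite /mu multiplicity_loopless // !inE setUid cards1. Qed.

Lemma mu_le2 (T : finType) (G : stdMultigraph T) x y : mu G x y <= 2.
Proof. exact: multiplicity_le2. Qed.

Lemma weight_num_edges (T : finType) (G : stdMultigraph T) :
  weight (mu G) [set: T] = 2 * num_edges G.
Proof.
rewrite -sum_ordered_pairs => [|x]; last by rewrite -(setUid [set x]) -/(mu G x x) mu_loopless.
have sumT (F : T -> nat) : \sum_(x in setT) F x = \sum_x F x.
  by apply: eq_bigl => x; rewrite inE.
by rewrite /weight sumT; apply: eq_bigr => x _; rewrite /degree_in sumT.
Qed.

Section MatchingGraph.

Variables (T : finType) (M : {set {set T}}).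

Let matching_mult (A : {set T}) : nat :=
  if A \in pairs T then (if A \in M then 1 else 2) else 0.

Fact matching_mult_loopless A : A \notin pairs T -> matching_mult A = 0.
Proof. by rewrite /matching_mult => /negPf ->. Qed.

Fact matching_mult_le2 A : matching_mult A <= 2.
Proof. by rewrite /matching_mult; case: ifP => // _; case: ifP. Qed.

Definition matching_graph : stdMultigraph T :=
  StdMultigraph matching_mult_loopless matching_mult_le2.

Lemma mu_matching_graph x y :
  x != y -> mu matching_graph x y = if [set x; y] \in M then 1 else 2.
Proof. by move=> nxy; rewrite /mu /= /matching_mult inE cards2 nxy. Qed.

End MatchingGraph.

Lemma admissible_contains_barK (T : finType) (G : stdMultigraph T) (K : {set T}) :
    admissible (mu G) K ->
  exists2 U : stdMultigraph 'I_#|K|, in_barK U & contains_copy G U.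
Proof.
move=> aK; pose phi (i : 'I_#|K|) := enum_val i.
have phiK i : phi i \in K by exact: enum_valP.
have phiI : injective phi by exact: enum_val_inj.
(* The light pairs of K, pulled back along [phi]. The condition also covers x = y, where it holds
   because [mu] vanishes on the diagonal. *)
pose M := [set A in pairs 'I_#|K| |
  [forall x in A, forall y in A, mu G (phi x) (phi y) < 2]].
have MP x y : x != y -> ([set x; y] \in M) = (mu G (phi x) (phi y) < 2).
  move=> nxy; rewrite !inE cards2 nxy; apply/idP/idP => [/forall_inP|lxy].
    by move/(_ x (set21 _ _))/forall_inP/(_ y (set22 _ _)).
  apply/forall_inP => u uP; apply/forall_inP => v; move: uP; rewrite !inE.
  by case/orP=> /eqP -> /orP[] /eqP ->; rewrite ?mu_loopless // mu_sym.
exists (matching_graph M); last first.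
  exists phi => // x y nxy; rewrite mu_matching_graph // MP //.
  have nphi : phi x != phi y by rewrite (inj_eq phiI).
  have := admissible_joined (mu_loopless G) (mu_le2 G) aK (phiK x) (phiK y) nphi.
  by case: ifP => //; lia.
exists M; last exact: mu_matching_graph.
have sMP : M \subset pairs _ by apply/subsetP => A; rewrite inE => /andP[].
(* Two members of M sharing x are light pairs at the same vertex, hence equal. *)
rewrite /matching sMP; apply/trivIsetP => A B AM BM; apply: contraNT.
case/pred0Pn => x /andP[/= xA xB].
have other (C : {set 'I_#|K|}) : C \in M -> x \in C ->
    exists y, [/\ C = [set x; y], x != y & mu G (phi x) (phi y) < 2].
  move=> CM; have := subsetP sMP _ CM; rewrite inE => /cards2P[a [b [nab eqC]]].
  move: CM; rewrite eqC MP // !inE => lab /orP[]/eqP ->; first by exists b.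
  by exists a; rewrite setUC eq_sym mu_sym.
have [y [-> nxy ly]] := other _ AM xA.
have [z [-> nxz lz]] := other _ BM xB.
suff /phiI -> : phi y = phi z by [].
by apply: (admissible_light_unique (mu_loopless G) (mu_le2 G) aK) ly lz;
   rewrite ?(inj_eq phiI).
Qed.

Theorem theorem4p2 (r n : nat) (hr : 2 <= r) (V : finType) (hV : #|V| = n)
    (G : stdMultigraph V) (hG : 2 * turan r.-1 n < num_edges G) :
  exists2 U : stdMultigraph 'I_r, in_barK U & contains_copy G U.
Proof.
case: (pickP (fun K : {set V} => admissible (mu G) K && (#|K| == r))) => [K|noK].
  by case/andP=> aK /eqP <-; exact: admissible_contains_barK.
(* With no admissible r-set, twice the number of edges is at most 4 [turan r.-1 n], against [hG]. *)
have := @weight_le_turan V (mu G) (@mu_sym V G) (mu_loopless G) (mu_le2 G) r.-1 setT.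
rewrite weight_num_edges cardsT hV => edges_le.
suff /edges_le : forall K : {set V},
    K \subset setT -> admissible (mu G) K -> #|K| <> r.-1.+1 by lia.
by move=> K _ aK; rewrite prednK ?(ltnW hr) // => /eqP cK; have := noK K; rewrite aK cK.
Qed.
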